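(* Let $(G,\gamma)$ be an edge-colored graph with $m$ edges and $\ell$ colors $c_1,\dots,c_\ell$, and let $(\delta_1,\delta_2,\ldots,\delta_m)$ be its dip sequence, that is, the dip numbers of all edges of $G$ arranged so that $\delta_1\geq\delta_2\geq\cdots\geq\delta_m$. Then \[\operatorname{wld}(G)\geq\min\left\{p:\delta_1+\delta_2+\cdots+\delta_p\geq\sum_{i=1}^{\ell}(\kappa(G_i)-1)\right\},\] where $p$ ranges over $\{0,1,\dots,m\}$ and the empty sum ($p=0$) is $0$.
   Context: An edge-colored graph $(G,\gamma)$ is a finite connected graph $G$ with a surjective function $\gamma:E(G)\to\mathcal{C}=\{c_1,\dots,c_\ell\}$ onto a finite set of colors (not necessarily a proper edge-coloring). For each color $c_i$ let $E_i(G)=\{e\in E(G):\gamma(e)=c_i\}$ and let $G_i$ be the graph with vertex set $V(G)$ and edge set $E_i(G)$; $\kappa(\cdot)$ denotes the number of connected components. For $W\subseteq E(G)$, let $G_i^W$ be the graph with vertex set $V(G)$ and edge set $W\cup E_i(G)$; write $G_i^{e}$ for $G_i^{\{e\}}$. The set $W$ is color-connecting if $G_i^W$ is connected for every color $c_i\in\mathcal{C}$. The wild number $\operatorname{wld}(G)$ is the minimum size of a color-connecting set. The dip number of an edge $e$ is $\delta(e)=\#\{i:\kappa(G_i^{e})<\kappa(G_i)\}=\sum_{i=1}^{\ell}(\kappa(G_i)-\kappa(G_i^{e}))$. *)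

(* Defs.v *)
From mathcomp Require Import all_boot.
Set Implicit Arguments.
Unset Strict Implicit.
Unset Printing Implicit Defensive.

(* Parallel edges and loops are allowed: an edge is an element of an abstract
   finite type with one (loop) or two end vertices.  A simple graph is the
   case where [ends] is injective with values of cardinality 2. *)
Section Graph.
Variables (V E : finType) (ends : E -> {set V}).
Implicit Type F : {set E}.

Definition adj F : rel V :=
  [rel x y | [exists e in F, ends e == [set x; y]]].

Definition kappa F : nat := n_comp (adj F) V.

Definition is_connected F : bool :=
  (0 < #|V|) && [forall x, forall y, connect (adj F) x y].

End Graph.

Record edge_colored_graph (l : nat) := EdgeColoredGraph {
  vertex : finType;
  edge : finType;
  ends : edge -> {set vertex};
  color : edge -> 'I_l;
  endsP : forall e, 0 < #|ends e| <= 2;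
  graph_connected : is_connected ends [set: edge];
  color_surj : forall i, exists e, color e = i
}.

Section EdgeColored.
Variables (l : nat) (G : edge_colored_graph l).

Definition color_class (i : 'I_l) : {set edge G} := [set e | color e == i].

(* Spanning subgraphs such as G_i and G_i^W are given by their edge sets. *)
Definition color_connecting (W : {set edge G}) : bool :=
  [forall i, is_connected (@ends l G) (W :|: color_class i)].

Lemma color_connectingT : color_connecting setT.
Proof. by apply/forallP=> i; rewrite setTU; apply: graph_connected. Qed.

(* The default [setT] is color-connecting (color_connectingT), so this is the
   minimum over a nonempty family. *)
Definition wld : nat :=
  #|[arg min_(W < [set: edge G] | color_connecting W) #|W|]|.

Definition dip (e : edge G) : nat :=
  #|[set i : 'I_l | kappa (@ends l G) (e |: color_class i)
                    < kappa (@ends l G) (color_class i)]|.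

Definition dip_seq : seq nat := sort geq [seq dip e | e : edge G].

(* 0-based indexing: [nth 0 dip_seq j] is delta_(j+1).  [dip_sum] is
   nondecreasing in p, so a lower bound on it that holds for some p <= #|edge G|
   holds for p = #|edge G|. *)
Definition dip_sum (p : nat) : nat := \sum_(j < p) nth 0 dip_seq j.

(* The vertex set is nonempty, so each kappa is positive and the subtraction
   is not truncated. *)
Definition total_deficit : nat :=
  \sum_(i < l) (kappa (@ends l G) (color_class i) - 1).

End EdgeColored.

(* Main.v *)
Require Import Defs.
From mathcomp Require Import all_boot.
Set Implicit Arguments.
Unset Strict Implicit.
Unset Printing Implicit Defensive.

(* Adding an edge e to an edge set F lowers the number of components by one if
   the ends of e lie in different components of F, and by nothing otherwise.
   Hence the drop caused by e can only shrink when F grows, so the total drop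
   caused by adding W to F is at most the sum over e in W of the drops of the
   single edges.  For a color-connecting W, summing over all colors bounds the
   total deficit by the sum of the dip numbers of the edges of W, which is at
   most the sum of the #|W| largest dip numbers. *)

Lemma card_le2_set2 (T : finType) (A : {set T}) :
  0 < #|A| <= 2 -> exists x y, A = [set x; y].
Proof.
case: (ltngtP #|A| 1) => [//|gt1 le2|/eqP/cards1P[x ->] _].
  have /cards2P[x [y [_ ->]]] : #|A| == 2 by rewrite eqn_leq gt1 andbT.
  by exists x, y.
by exists x, x; rewrite setUid.
Qed.

Section Components.
Variables (V E : finType) (ends : E -> {set V}).
Implicit Types (F W : {set E}) (e : E) (x y : V).

Lemma adj_sym F : symmetric (adj ends F).
Proof. by move=> x y /=; apply: eq_existsb => e; rewrite setUC. Qed.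

Lemma connect_adj_sym F : connect_sym (adj ends F).
Proof. exact/sym_connect_sym/adj_sym. Qed.

Lemma connect_adjS F W : F \subset W ->
  subrel (connect (adj ends F)) (connect (adj ends W)).
Proof.
move=> FW; apply: connect_sub => x y /exists_inP[e eF exy].
by apply/connect1/exists_inP; exists e; rewrite ?(subsetP FW).
Qed.

Lemma adj_setU1 F e x y u v : ends e = [set x; y] ->
  adj ends (e |: F) u v ->
  adj ends F u v || (u \in pred2 x y) && (v \in pred2 x y).
Proof.
move=> exy /exists_inP[f]; rewrite in_setU1 => /predU1P[-> | fF] fuv.
  rewrite exy in fuv; apply/orP; right.
  have := set21 u v; have := set22 u v.
  by rewrite -(eqP fuv) !inE => -> ->.
by apply/orP; left; apply/exists_inP; exists f.
Qed.

(** [n_comp] counts the roots lying in [a], and the root of a point is picked from the points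
    reachable from it, so only reachability from [a] matters. *)
Lemma eq_in_n_comp (r1 r2 : rel V) (a : {pred V}) :
  {in a, forall x, connect r1 x =1 connect r2 x} -> n_comp r1 a = n_comp r2 a.
Proof.
move=> r12; apply: eq_card => x; rewrite !inE.
have [xa|] := boolP (x \in a); last by rewrite !andbF.
by rewrite /roots /root (eq_pick (r12 x xa)).
Qed.

(** Split the vertices into [a], the union of the [F]-components of [x] and [y], and its complement.
    Inside [a] there are one or two components before adding [e] and exactly one after; outside
    nothing changes. *)
Lemma kappa_setU1 F e x y : ends e = [set x; y] ->
  kappa ends F = kappa ends (e |: F) + ~~ connect (adj ends F) x y.
Proof.
move=> exy; set r := adj ends F; set r' := adj ends (e |: F).
pose a := closure r (pred2 x y).
have cr : connect_sym r by apply: connect_adj_sym.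
have cr' : connect_sym r' by apply: connect_adj_sym.
have sub : subrel (connect r) (connect r') by apply/connect_adjS/subsetUr.
have a_r : closed r a by apply: closure_closed.
have a_xy : {subset pred2 x y <= a} by apply: mem_closure.
have a_r' : closed r' a.
  apply: intro_closed => // u v /(adj_setU1 exy)/orP[ruv|/andP[_ va]] ua.
    by rewrite -(a_r _ _ ruv).
  exact: a_xy.
have r'xy : connect r' x y.
  by apply/connect1/exists_inP; exists e; rewrite ?setU11 ?exy.
have eq_a : a =i connect r' x.
  move=> z; apply/idP/idP => [/existsP[t /andP[/sub zt txy]] | xz].
    rewrite -topredE /= cr' (connect_trans zt) // cr'.
    by case/pred2P: txy => ->.
  by rewrite -(closed_connect a_r' xz) a_xy // inE eqxx.
rewrite /kappa (n_compC a r) (n_compC a r') n_comp_closure2 //.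
rewrite (eq_n_comp_r eq_a) n_comp_connect //.
suff -> : n_comp r [predC a] = n_comp r' [predC a] by rewrite addnAC add1n.
(* A path starting outside the closed set [a] stays outside it, so it never uses [e], whose ends lie
   in [a]. *)
apply: eq_in_n_comp => u ua v; apply/idP/idP => [/sub // | /connectP[p]].
elim: p u ua => [|w p IHp] u ua /= => [_ -> //|/andP[uw pw] v_last].
have wa : w \in [predC a] by rewrite !inE -(a_r' _ _ uw).
apply: connect_trans (IHp w wa pw v_last).
case/orP: (adj_setU1 exy uw) => [/connect1 // | /andP[/a_xy ua' _]].
by rewrite inE ua' in ua.
Qed.

Lemma kappa_connected F : is_connected ends F -> kappa ends F = 1.
Proof.
case/andP=> /card_gt0P[x _] /forallP conF.
rewrite -(n_comp_connect (connect_adj_sym F) x); apply: eq_n_comp_r => y.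
exact/esym/(forallP (conF x)).
Qed.

Hypothesis endsP : forall e, 0 < #|ends e| <= 2.

Lemma kappa_setU1_bound F e :
  kappa ends (e |: F) <= kappa ends F <= (kappa ends (e |: F)).+1.
Proof.
have [x [y exy]] := card_le2_set2 (endsP e).
by rewrite (kappa_setU1 F exy) leq_addr -addn1 leq_add2l leq_b1.
Qed.

Lemma kappa_drop_anti F W e : F \subset W ->
  kappa ends W - kappa ends (e |: W) <= kappa ends F - kappa ends (e |: F).
Proof.
move=> FW; have [x [y exy]] := card_le2_set2 (endsP e).
rewrite (kappa_setU1 F exy) (kappa_setU1 W exy) !addKn.
case: (boolP (connect _ x y)) => // /negP nW.
by case: (boolP (connect _ x y)) => // /(connect_adjS FW).
Qed.

Lemma kappa_setU F W :
  kappa ends F - kappa ends (W :|: F)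
    <= \sum_(e in W) (kappa ends F - kappa ends (e |: F)).
Proof.
have [n] := ubnP #|W|; elim: n W => // n IHn W leWn.
have [->|[e eW]] := set_0Vmem W; first by rewrite set0U subnn.
rewrite (big_setD1 e) //= -{1}(setD1K eW) -setUA addnC.
have {}IHn := IHn (W :\ e); rewrite (cardsD1 e) eW in leWn.
apply: leq_trans (leq_add (IHn leWn) (kappa_drop_anti e (subsetUr (W :\ e) F))).
(* What remains is the triangle inequality for truncated subtraction, with middle term
   [kappa ends (W :\ e :|: F)]. *)
by rewrite leq_subLR addnCA addnC -leq_subLR leq_sub2l // -leq_subLR.
Qed.

End Components.

(** The head of [t] is its maximum, so it dominates the head of [s]. Whether or not the two heads
    are matched, the tail of [s] is a subsequence of the tail of [t], and induction applies. *)
Lemma sumn_subseq_sorted (s t : seq nat) : sorted geq t -> subseq s t ->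
  sumn s <= sumn (take (size s) t).
Proof.
elim: t s => [|x t IHt] [|y s] //= t_sorted st.
have ge_trans : transitive geq by move=> a b c ab bc; apply: leq_trans bc ab.
have yx : y <= x.
  case: eqVneq st => [-> //|_ st].
  have /allP := order_path_min ge_trans t_sorted.
  by apply; apply: mem_subseq st _ _; apply: mem_head.
apply: leq_add yx (IHt _ (path_sorted t_sorted) _).
by case: eqP st => // _; apply: subseq_trans (subseq_cons _ _).
Qed.

Section DipNumbers.
Variables (l : nat) (G : edge_colored_graph l).
Implicit Type W : {set edge G}.

(** A single edge lowers [kappa] by 0 or 1, so counting the colors with a drop is the same as adding
    up the drops. *)
Lemma dipE (e : edge G) :
  dip e = \sum_(i < l) (kappa (@ends l G) (color_class G i)
                        - kappa (@ends l G) (e |: color_class G i)).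
Proof.
rewrite /dip -sum1_card big_mkcond; apply: eq_bigr => i _; rewrite inE.
have /andP[] := kappa_setU1_bound (@endsP l G) (color_class G i) e.
case: (ltngtP (kappa _ _)) => // [lt _ le|<-]; last by rewrite subnn.
by apply/esym/eqP; rewrite eqn_leq leq_subLR addn1 le subn_gt0.
Qed.

Lemma deficit_le_sum_dip W :
  color_connecting W -> total_deficit G <= \sum_(e in W) dip e.
Proof.
move=> /forallP ccW; rewrite (eq_bigr _ (fun e _ => dipE e)) exchange_big.
(* The 1 subtracted in the deficit is the number of components once [W] is added to the color
   class. *)
apply: leq_sum => i _; rewrite -(kappa_connected (ccW i)).
exact: kappa_setU (@endsP l G) _ _.
Qed.

Lemma sum_dip_le_dip_sum W : \sum_(e in W) dip e <= dip_sum G #|W|.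
Proof.
(* Sorting the edges themselves, not just their dip numbers, makes the dip numbers of [W] a
   subsequence of [dip_seq G], even when values repeat. *)
pose es := sort (relpre (@dip l G) geq) (enum (edge G)).
have dipS : dip_seq G = map (@dip l G) es by rewrite /dip_seq sort_map.
pose ws := [seq e <- es | e \in W].
have ws_enum : perm_eq ws (enum W).
  apply: uniq_perm (enum_uniq _) _ => [|e].
    by rewrite filter_uniq // sort_uniq enum_uniq.
  by rewrite mem_filter mem_sort !mem_enum andbT.
have -> : \sum_(e in W) dip e = sumn [seq dip e | e <- ws].
  by rewrite sumnE big_map (perm_big _ ws_enum) big_enum.
have size_ws : size [seq dip e | e <- ws] = #|W|.
  by rewrite size_map (perm_size ws_enum) -cardE.
have leW : #|W| <= size (dip_seq G).
  by rewrite size_sort size_map -cardE max_card.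
have -> : dip_sum G #|W| = sumn (take #|W| (dip_seq G)).
  rewrite /dip_sum sumnE (big_nth 0) size_takel // big_mkord.
  by apply: eq_bigr => j _; rewrite nth_take.
rewrite -size_ws; apply: sumn_subseq_sorted.
  by apply: sort_sorted => m n; apply: leq_total.
by rewrite dipS; apply/map_subseq/filter_subseq.
Qed.

End DipNumbers.

Theorem proposition5p6 (l : nat) (G : edge_colored_graph l) :
  wld G >= [arg min_(p < (ord_max : 'I_(#|edge G|.+1))
                     | dip_sum G p >= total_deficit G) (p : nat)].
Proof.
have bound (W : {set edge G}) :
  color_connecting W -> total_deficit G <= dip_sum G #|W|.
  move=> ccW; exact: leq_trans (deficit_le_sum_dip ccW) (sum_dip_le_dip_sum W).
rewrite /wld; case: (arg_minnP _ (color_connectingT G)) => W ccW _.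
have ltW : #|W| < #|edge G|.+1 by rewrite ltnS max_card.
case: arg_minnP => /= [|p _ min_p].
  (* The default [ord_max] is admissible because the full edge set is color-connecting. *)
  by have := bound _ (color_connectingT G); rewrite cardsT.
(* The size of an optimal [W] is itself an admissible [p]. *)
exact: (min_p (Ordinal ltW)) (bound W ccW).
Qed.
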